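(* Let $X$ be a topological space of countable pseudocharacter that admits a continuous bijection onto a hereditarily paracompact subspace of an ordinal. If $\operatorname{ind}(X)=0$, then $X$ admits a continuous bijection onto a first-countable hereditarily paracompact subspace of an ordinal.
   Context: Terminology follows Engelking's ''General Topology''. A space $X$ has countable pseudocharacter if every singleton $\{x\}$, $x\in X$, is the intersection of a countable family of open subsets of $X$. $\operatorname{ind}$ denotes the small inductive dimension; $\operatorname{ind}(X)=0$ means that $X$ is nonempty and has a base consisting of clopen sets. A space is hereditarily paracompact if each of its subspaces is paracompact (paracompact spaces are assumed Hausdorff). Every ordinal is considered with its order topology, and a subspace of an ordinal is a subset of an ordinal with the subspace topology. The two ordinals (in the hypothesis and in the conclusion) need not be the same. A continuous bijection need not have a continuous inverse. *)

(* Defs.v *)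
From HB Require Import structures.
From mathcomp Require Import all_boot all_order.
From mathcomp Require Import all_classical topology.
From mathcomp Require wochoice.
Set Implicit Arguments.
Unset Strict Implicit.
Unset Printing Implicit Defensive.
Local Open Scope classical_set_scope.

Definition countable_pseudocharacter (T : topologicalType) : Prop :=
  forall x : T, exists F : set (set T),
    [/\ countable F, F `<=` open & \bigcap_(U in F) U = [set x]].

Definition first_countable (T : topologicalType) : Prop :=
  forall x : T, exists B : set (set T),
    [/\ countable B, B `<=` [set U | open U /\ U x]
      & forall V, nbhs x V -> exists2 U, B U & U `<=` V].

(* Not the library's [zero_dimensional], which only separates points by clopen
   sets. *)
Definition ind_eq0 (T : topologicalType) : Prop :=
  [set: T] !=set0 /\ exists2 B : set (set T), basis B & B `<=` clopen.

Definition open_cover (T : topologicalType) (C : set (set T)) : Prop :=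
  C `<=` open /\ cover C id = [set: T].

Definition refines (T : Type) (D C : set (set T)) : Prop :=
  forall V, D V -> exists2 U, C U & V `<=` U.

Definition locally_finite (T : topologicalType) (D : set (set T)) : Prop :=
  forall x : T, exists2 N, nbhs x N &
    finite_set [set V | D V /\ V `&` N !=set0].

Definition paracompact (T : topologicalType) : Prop :=
  hausdorff_space T /\
  forall C : set (set T), open_cover C ->
    exists D, [/\ open_cover D, refines D C & locally_finite D].

(* [set_type A] carries the subspace topology; [subspace A] would not do, since
   it retains the points outside [A] as isolated points. *)
Definition hereditarily_paracompact (T : topologicalType) : Prop :=
  forall A : set T, paracompact (set_type A).

(* Ordinals are taken up to order isomorphism: an ordinal with its order
   topology is a well-ordered [orderTopologicalType] (possibly empty). *)
Definition is_ordinal d (alpha : orderTopologicalType d) : Prop :=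
  wochoice.well_order (fun x y : alpha => (x <= y)%O).

Definition continuous_bijection (S T : topologicalType) (f : S -> T) : Prop :=
  continuous f /\ bijective f.

(* Main.v *)
Require Import Defs.
From HB Require Import structures.
From mathcomp Require Import all_boot all_order.
From mathcomp Require Import interval.
From mathcomp Require Import all_classical topology.
From mathcomp Require wochoice.
Set Implicit Arguments.
Unset Strict Implicit.
Unset Printing Implicit Defensive.
Import Order.TTheory.
Local Open Scope order_scope.
Local Open Scope classical_set_scope.

(* If A is a hereditarily paracompact subset of an ordinal and Q is an initial
   segment, then A `&` Q splits into clopen pieces that are bounded in Q.  This
   is clear if Q has countable cofinality; otherwise paracompactness yields a
   regressive function l on A `&` Q such that { x | l x <= c } is bounded in Q
   for every c, and one cuts at the closure points of l.
   A point p of X has clopen neighbourhoods U_n with intersection {p}, so X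
   minus p is the disjoint union of the clopen sets V_n of those x for which n
   is least with x outside U_n.  By induction on b, every set S of points mapped
   to ordinals <= b has a suitable well-order: if p in S is mapped to b, cut each
   V_n into pieces mapped strictly below b, concatenate their well-orders, first
   along the pieces of V_0, then of V_1, and so on, and put p on top; it now has
   countable cofinality.  Finally X becomes a subspace of an ordinal by sending
   x to (x, 1) if x is isolated and to (x, 0) otherwise, in the lexicographic
   product of the well-ordered set X with 2. *)

(** * Well-foundedness and finite intersections of neighbourhoods *)

Definition well_founded_le d (T : porderType d) : Prop :=
  forall P : set T, P !=set0 -> exists2 m, P m & forall z, P z -> m <= z.

Lemma ordinal_well_founded_le d (alpha : orderTopologicalType d) :
  is_ordinal alpha -> well_founded_le alpha.
Proof.
move=> wo P [x Px].
have [|z [[zP zmin] _]] := wo (mem P); first by exists x; exact/mem_set.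
by exists z; [exact/set_mem | move=> y Py; apply: zmin; exact/mem_set].
Qed.

Lemma nat_well_founded_le : well_founded_le nat.
Proof.
move=> P [x Px].
have exP : exists n, `[<P n>] by exists x; exact/asboolP.
case: (ex_minnP exP) => m /asboolP Pm mmin; exists m => // z Pz.
by rewrite leEnat; apply: mmin; exact/asboolP.
Qed.

Lemma well_founded_le_ind d (T : orderType d) (P : T -> Prop) :
  well_founded_le T -> (forall x, (forall y, y < x -> P y) -> P x) ->
  forall x, P x.
Proof.
move=> wo IH x; apply: contrapT => nPx.
have [|m nPm mmin] := wo [set y | ~ P y]; first by exists x.
apply: nPm; apply: IH => y ym; apply: contrapT => /mmin.
by rewrite leNgt ym.
Qed.

Lemma nbhs_forall_ltn (T : topologicalType) (x : T) (U : nat -> set T) n :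
  (forall m, (m < n)%N -> nbhs x (U m)) ->
  nbhs x [set z | forall m, (m < n)%N -> U m z].
Proof.
elim: n => [|n IHn] Un; first exact: filterE.
have IH := IHn (fun m mn => Un m (ltnW mn)).
apply: filterS (filterI IH (Un n (ltnSn n))) => z [h nz] m.
by rewrite ltnS leq_eqVlt => /orP[/eqP->//|]; exact: h.
Qed.

(** * Initial segments of hereditarily paracompact subsets of ordinals *)

Section Ordinals.
Context d (alpha : orderTopologicalType d).
Hypothesis wo : well_founded_le alpha.
Implicit Types (x y z : alpha) (A Q : set alpha).

Lemma nbhs_rray x y : x < y -> nbhs y [set z | x < z].
Proof.
move=> xy; apply: open_nbhs_nbhs; split => //.
by have := @rray_open _ alpha x; rewrite set_itvoy.
Qed.

(** Unless [x] is the greatest element, this set is the open ray below the successor of [x]. *)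
Lemma open_le x : open [set z | z <= x].
Proof.
have [[s xs]|nox] := pselect (exists s, x < s); last first.
  suff -> : [set z | z <= x] = setT by exact: openT.
  by apply/seteqP; split => // z _ /=; rewrite leNgt; apply/negP => xz;
    apply: nox; exists z.
have [|m xm mmin] := wo (P := [set s | x < s]); first by exists s.
have := @lray_open _ alpha m; rewrite set_itvNyo; congr open.
apply/seteqP; split => z /=; last by move=> zx; exact: le_lt_trans xm.
by rewrite leNgt => zm; apply/negP => /mmin; rewrite leNgt zm.
Qed.

Lemma nbhs_lray x y : y <= x -> nbhs y [set z | z <= x].
Proof. by move=> yx; apply: open_nbhs_nbhs; split => //; exact: open_le. Qed.

(** Together with [open_le], this makes the intervals ]l, x] a neighbourhood base at every [x] but
    the least element. *)
Lemma nbhs_interval_left x (O : set alpha) : nbhs x O ->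
  (exists2 l, l < x & forall z, l < z -> z <= x -> O z) \/ (forall z, x <= z).
Proof.
rewrite itv_nbhsE => -[[p q] [op xpq] sO].
have [[l lx]|nox] := pselect (exists z, z < x); last first.
  by right => z; rewrite leNgt; apply/negP => zx; apply: nox; exists z.
left; move: xpq; rewrite itv_boundlr => /andP[px xq].
have [l' l'x pl'] : exists2 l', l' < x &
    forall z, l' < z -> (p <= BLeft z)%O.
  case: p op px {sO} => [b p|[]//] op px; last by exists l.
  rewrite (itv_open_ends_lside op) in px *.
  by exists p => [|z]; rewrite ?bnd_simp // in px *.
exists l' => // z l'z zx; apply: sO => /=; rewrite itv_boundlr pl' //=.
by apply: le_trans xq; rewrite bnd_simp.
Qed.

(** Paracompactness is applied to the cover of the part of [A] in [Q] by the initial segments with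
    last element in [Q]. The refinement is pushed forward to [alpha], and its local finiteness is
    read on intervals ]l, x]. *)
Lemma bounded_locally_finite_cover A Q :
  hereditarily_paracompact (set_type A) ->
  exists2 D : set (set alpha),
    (forall V, D V -> exists2 b, Q b & forall x, A x -> Q x -> V x -> x <= b) /\
    (forall x, A x -> Q x -> exists2 V, D V & V x) &
    forall x, A x -> Q x -> (exists2 l, l < x &
       finite_set [set V | D V /\ exists z, [/\ A z, l < z, z <= x & V z]])
    \/ forall z, x <= z.
Proof.
move=> hpA.
pose Y : set (set_type A) := [set a | Q (val a)].
have [_ /(_ [set U | exists2 b, Q b &
  U = [set y : set_type Y | val (val y) <= b]])] := hpA Y.
have cvv : continuous (fun y : set_type Y => val (val y) : alpha).
  move=> y; apply: continuous_comp; exact: initial_continuous.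
case.
  split=> [_ [b Qb ->]|].
    by apply: (@open_comp _ _ (fun y : set_type Y => val (val y) : alpha)
      [set z | z <= b]) => [y _|]; [exact: cvv|exact: open_le].
  apply/seteqP; split=> // y _;
    exists [set z : set_type Y | val (val z) <= val (val y)] => //=.
  exists (val (val y)) => //; exact: set_valP y.
move=> D [[opD covD] refD lfD].
have mk x' (Ax : A x') (Qx : Q x') : exists y : set_type Y, val (val y) = x'.
  have aA : x' \in A by exact/mem_set.
  have yY : (exist _ x' aA : set_type A) \in Y by exact/mem_set.
  by exists (exist (fun y : set_type A => y \in Y) _ yY).
exists [set V | exists2 W, D W & V = [set val (val y) | y in W]].
  split=> [V [W DW ->]|x' Ax Qx].
    have [_ [b Qb ->] sW] := refD _ DW.
    by exists b => // z _ _ [y Wy <-]; exact: sW.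
  have [y yx] := mk _ Ax Qx.
  have : [set: set_type Y] y by [].
  rewrite -covD => -[W DW Wy].
  exists [set val (val y) | y in W]; first by exists W.
  by exists y.
move=> x' Ax Qx; have [y yx] := mk _ Ax Qx.
have [N [O [[O1 [O2 oO2 <-] O21]] O2y sON] finN] := lfD y.
have : nbhs x' O2.
  apply: open_nbhs_nbhs; split => //.
  by move: O2y; rewrite -O21 -yx.
case/nbhs_interval_left => [[l lx sO]|]; [left|by right].
exists l => //.
apply: (@sub_finite_set _ _ [set [set val (val y) | y in W] |
  W in [set W | D W /\ W `&` N !=set0]]); last exact: finite_image.
move=> _ [[W DW ->] [z [Az lz zx [w Ww wz]]]]; exists W => //; split => //.
exists w; split => //; apply: sON; rewrite -O21.
by have : O2 z by [exact: sO]; rewrite -wz.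
Qed.

(** This performs the cutting: the pieces are the fibres of [e], and the value of [e] on a piece is
    its bound in [Q]. *)
Lemma locally_constant_bound A Q :
  hereditarily_paracompact (set_type A) ->
  (forall x y, Q y -> x <= y -> Q x) ->
  exists e : alpha -> alpha, forall x, A x -> Q x ->
    [/\ Q (e x), x <= e x & nbhs x [set z | A z -> Q z -> e z = e x]].
Proof.
move=> hpA Qle.
(* With a cofinal sequence [u], [x] goes to the first term that is at least [x]. A [Q] with a
   greatest element falls under this case, by a constant sequence. *)
have [[u [Qu ucof]]|nocof] := pselect (exists u : nat -> alpha,
    (forall n, Q (u n)) /\ forall x, Q x -> exists n, x <= u n).
  have least x : exists n, Q x -> x <= u n /\ forall m, (m < n)%N -> u m < x.
    have [Qx|] := pselect (Q x); last by exists 0%N.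
    have [n xn nmin] := @nat_well_founded_le [set n | x <= u n] (ucof x Qx).
    exists n => _; split => // m; rewrite ltNge => mn.
    by apply/negP => /nmin; rewrite leEnat leqNgt mn.
  have [k kP] := choice least.
  exists (fun x => u (k x)) => x Ax Qx; have [xk kx] := kP x Qx; split => //.
  have : nbhs x [set z | forall m, (m < k x)%N -> u m < z].
    by apply: nbhs_forall_ltn => m mk; exact/nbhs_rray/kx.
  move=> kn; apply: filterS (filterI (nbhs_lray xk) kn) => z [zk kz] Az Qz /=.
  have [zkz kzz] := kP z Qz; congr u; apply/eqP.
  rewrite eqn_leq; apply/andP; split; rewrite leqNgt; apply/negP.
    by move=> /kzz; rewrite ltNge zk.
  by move=> /kz; rewrite ltNge zkz.
have unb (u : nat -> alpha) : (forall n, Q (u n)) ->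
    exists2 b, Q b & forall n, u n < b.
  move=> Qu; apply: contrapT => nb; apply: nocof; exists u; split => // x Qx.
  apply: contrapT => nx; apply: nb; exists x => // n.
  by rewrite ltNge; apply/negP => xn; apply: nx; exists n.
have [D [Dbd covD] finD] := bounded_locally_finite_cover Q hpA.
(* At the least element of [alpha] nothing lies below [x], and [l x = x] is a default. *)
have /choice[l lP] x : exists l, A x -> Q x ->
    (l < x /\ finite_set
      [set V | D V /\ exists z, [/\ A z, l < z, z <= x & V z]])
    \/ (forall z, x <= z) /\ l = x.
  have [[Ax Qx]|nAQ] := pselect (A x /\ Q x); last first.
    by exists x => Ax Qx; exfalso; apply: nAQ.
  by have [[y yx fy]|minx] := finD x Ax Qx; [exists y; left|exists x; right].
(* Otherwise the sets V n below, which contain points farther and farther above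
   g, are distinct and all meet ]l x, x] for some x, against local
   finiteness. *)
have step g : exists g',
    Q g -> Q g' /\ forall x, A x -> Q x -> l x <= g -> x <= g'.
  have [Qg|] := pselect (Q g); last by exists g.
  apply: contrapT => nb.
  have far b : Q b -> exists x, [/\ A x, Q x, l x <= g & b < x].
    move=> Qb; apply: contrapT => nx; apply: nb; exists b => _;
      split => // x Ax Qx lx.
    by rewrite leNgt; apply/negP => bx; apply: nx; exists x.
  have next b : exists b'V : alpha * set alpha, Q b ->
    [/\ Q b'V.1, b <= b'V.1, D b'V.2,
      (exists x, [/\ A x, Q x, g < x, b < x & x <= b'V.1 /\ b'V.2 x]) &
      forall x, A x -> Q x -> b'V.2 x -> x <= b'V.1].
    have [Qb|] := pselect (Q b); last by exists (b, set0).
    have [|x [Ax Qx _]] := far (Order.max b g); first by case: leP.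
    rewrite gt_max => /andP[bx gx].
    have [V DV Vx] := covD x Ax Qx; have [b' Qb' Vb'] := Dbd V DV.
    exists (b', V) => _; split => //=; first by apply: (le_trans (ltW bx));
      exact: Vb'.
    by exists x; split => //; split => //; exact: Vb'.
  have [F FP] := choice next.
  pose b n := iter n (fun b => (F b).1) g.
  have Qb n : Q (b n) by elim: n => //= n /FP[].
  have bS n : b n <= b n.+1 by have [] := FP _ (Qb n).
  have bmono : {homo b : m n / (m <= n)%N >-> m <= n}.
    by apply: homo_leq => // [x y z]; exact: le_trans.
  (* The bound [c] exists because no sequence is cofinal in [Q]. As [l x <= g] and [c < x], the
     points chosen in the sets [V n] all lie between [l x] and [x]. *)
  have [c Qc bc] := unb b Qb.
  have [x [Ax Qx lxg cx]] := far c Qc.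
  have [[lx]|[minx _]] := lP x Ax Qx; last first.
    by have := lt_le_trans cx (minx c); rewrite ltxx.
  pose V n := (F (b n)).2.
  have VP n : [/\ D (V n),
      (exists x, [/\ A x, Q x, g < x, b n < x & x <= b n.+1 /\ V n x]) &
      forall x, A x -> Q x -> V n x -> x <= b n.+1].
    by have [] := FP _ (Qb n).
  have Vlt m n : (m < n)%N -> V m = V n -> False.
    move=> mn Vmn; have [_ [y [Ay Qy _ yb [_ Vy]]] _] := VP n.
    have [_ _ /(_ y Ay Qy)] := VP m; rewrite Vmn => /(_ Vy).
    by rewrite leNgt (le_lt_trans (bmono _ _ mn)).
  move=> fin; apply: infinite_nat.
  have Vinj : {in V @^-1` [set V | D V /\
      exists z, [/\ A z, l x < z, z <= x & V z]] &, injective V}.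
    by move=> m n _ _ Vmn; case: (ltngtP m n) => // h; exfalso; apply: Vlt h _.
  apply: sub_finite_set (finite_preimage Vinj fin) => n _.
  have [DV [y [Ay Qy gy _ [yb Vy]]] _] := VP n; split => //; exists y;
    split => //.
    exact: le_lt_trans gy.
  by rewrite (le_trans yb)// ltW// (lt_trans (bc n.+1)).
have [h hP] := choice step.
(* The interval ]l x, x] contains no cut point but possibly x, so the least cut
   point above is locally constant. *)
pose C := [set c | Q c /\ forall x, A x -> Q x -> l x < c -> x <= c].
(* The supremum [s] of the iterates of [h] at [x] is a closure point: if [l y < s], then [l y < c n]
   for some [n], so [y <= c n.+1 <= s]. *)
have cofC x : Q x -> exists2 c, C c & x <= c.
  move=> Qx; pose c n := iter n h x.
  have Qc n : Q (c n) by elim: n => //= n /hP[].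
  have [b Qb cb] := unb c Qc.
  have [|s /= cs smin] := wo (P := [set s | forall n, c n <= s]).
    by exists b => n; exact: ltW.
  exists s; last exact: (cs 0%N).
  split; first by apply: Qle Qb _; apply: smin => n; exact: ltW.
  move=> y Ay Qy ls; have [n lc] : exists n, l y < c n.
    apply: contrapT => nn; suff : s <= l y by rewrite leNgt ls.
    by apply: smin => n; rewrite leNgt; apply/negP => lc; apply: nn; exists n.
  apply: le_trans (cs n.+1); have [_] := hP _ (Qc n); apply => //; exact: ltW.
have /choice[e eP] x : exists e, Q x ->
    [/\ C e, x <= e & forall c, C c -> x <= c -> e <= c].
  have [Qx|] := pselect (Q x); last by exists x.
  have [c Cc xc] := cofC x Qx.
  have [|m [Cm xm] mmin] := wo (P := [set c | C c /\ x <= c]);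
    first by exists c.
  by exists m => _; split => // c' Cc' xc'; exact: mmin.
exists e => x Ax Qx; have [Cex xe emin] := eP x Qx.
split => //; first by case: Cex.
have : nbhs x [set z | z <= x /\ (l x < z \/ z = x)].
  have [[lx _]|[minx _]] := lP x Ax Qx.
    by apply: filterS (filterI (nbhs_rray lx) (nbhs_lray (lexx x))) =>
      z [lz zx]; split => //; left.
  by apply: filterS (nbhs_lray (lexx x)) => z zx; split => //; right;
    apply/le_anti; rewrite zx minx.
apply: filterS => z [zx [lz|->//]] Az Qz /=.
(* Since [l x < z <= e z] and [e z] is a closure point, [x <= e z], hence [e x <= e z]. *)
have [Cez ze ezmin] := eP z Qz; apply/le_anti.
rewrite ezmin ?(le_trans zx)//= emin//; case: Cez => _ /(_ x Ax Qx); apply.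
exact: lt_le_trans ze.
Qed.
End Ordinals.

(** * Sets with a first-countable hereditarily paracompact well-order *)

(** Totality and transitivity come from least elements of sets of two and three points. Relativizing
    to [S] allows orders on disjoint sets to be glued without subtypes. *)
Definition well_orders (T : Type) (S : set T) (R : T -> T -> Prop) : Prop :=
  (forall x y, S x -> S y -> R x y -> R y x -> x = y) /\
  (forall P : set T, P `<=` S -> P !=set0 ->
     exists2 m, P m & forall z, P z -> R m z).

Section WellOrders.
Context (T : Type) (S : set T) (R : T -> T -> Prop).
Hypothesis woR : well_orders S R.

Lemma well_orders_total x y : S x -> S y -> R x y \/ R y x.
Proof.
move=> Sx Sy; have [|| m [->|->] mP] := woR.2 [set z | z = x \/ z = y].
- by move=> z [->|->].
- by exists x; left.
- by left; apply: mP; right.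
- by right; apply: mP; left.
Qed.

Lemma well_orders_refl x : S x -> R x x.
Proof. by move=> Sx; case: (well_orders_total Sx Sx). Qed.

Lemma well_orders_trans x y z : S x -> S y -> S z -> R x y -> R y z -> R x z.
Proof.
move=> Sx Sy Sz xy yz.
have [||m mP mmin] := woR.2 [set t | [\/ t = x, t = y | t = z]].
- by move=> t [->|->|->].
- by exists x; constructor.
have mx : R m x by apply: mmin; constructor.
have my : R m y by apply: mmin; constructor.
have mz : R m z by apply: mmin; constructor.
case: mP => ?; subst m => //.
- by rewrite (woR.1 _ _ Sx Sy xy mx).
- by rewrite -(woR.1 _ _ Sy Sz yz my).
Qed.

End WellOrders.

Section GoodSets.
Context (X : topologicalType).
Implicit Types (S T U : set X) (R : X -> X -> Prop).

Definition isolated_in S x := nbhs x [set z | S z -> z = x].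

(* The points isolated for the topology of X stay isolated; the others have the
   order neighbourhoods ]y, x].  Here [~ R x y] is the strict [y < x]. *)
Definition interval_nbhs S R x U : Prop :=
  U x /\ (isolated_in S x \/ exists2 y, S y /\ ~ R x y &
    forall z, S z -> ~ R z y -> R z x -> U z).

(* P x is the piece containing x of a clopen partition of T that refines the
   neighbourhood assignment N; for this topology it is hereditary
   ultraparacompactness. *)
Definition partitionable S R : Prop :=
  forall T (N : X -> set X), T `<=` S ->
    (forall x, T x -> interval_nbhs S R x [set z | T z -> N x z]) ->
  exists P : X -> set X, forall x, T x ->
    [/\ P x x, interval_nbhs S R x [set z | T z -> P x z],
        forall z, T z -> P x z -> P z = P x
      & exists2 y, T y & forall z, T z -> P x z -> N y z].

(** The last three clauses concern the interval topology on [S]: it is coarser than the topology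
    induced by [X], first countable, and hereditarily ultraparacompact. *)
Definition good_order S R : Prop :=
  [/\ well_orders S R,
      forall x U, S x -> interval_nbhs S R x U -> nbhs x [set z | S z -> U z],
      forall x, S x -> exists2 u : nat -> set X,
        forall n, interval_nbhs S R x (u n)
        & forall U, interval_nbhs S R x U ->
            exists n, forall z, S z -> u n z -> U z
    & partitionable S R].

Definition good S : Prop := exists R, good_order S R.

(** The countable base at [x] is indexed by [nat], hence not empty; so the least point of [S] must
    be isolated. *)
Lemma good_order_interval_nbhsT S R x : good_order S R -> S x ->
  interval_nbhs S R x setT.
Proof.
move=> [_ _ + _] Sx => /(_ x Sx)[u uP _]; have [_ []] := uP 0%N; split => //.
- by left.
- by right; case: b => y ? _; exists y.
Qed.

Lemma interval_nbhsW S R x U V : S x -> (forall z, S z -> U z -> V z) ->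
  interval_nbhs S R x U -> interval_nbhs S R x V.
Proof.
move=> Sx UV [Ux] [iso|[y [Sy xy] yU]]; split; [exact: UV|by left|exact: UV|].
by right; exists y => // z Sz zy zx; apply: UV => //; exact: yU.
Qed.

Lemma interval_nbhsI S R x U V : well_orders S R -> S x ->
  interval_nbhs S R x U -> interval_nbhs S R x V ->
  interval_nbhs S R x (U `&` V).
Proof.
move=> wo Sx [Ux hU] [Vx hV]; split => //.
case: hU => [|[y [Sy xy] yU]]; first by left.
case: hV => [|[w [Sw xw] wV]]; first by left.
have [yw|wy] := well_orders_total wo Sy Sw; right.
- exists w => // z Sz zw zx; split; [apply: yU|apply: wV] => // zy.
  by apply: zw; apply: (well_orders_trans wo) yw.
- exists y => // z Sz zy zx; split; [apply: yU|apply: wV] => // zw.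
  by apply: zy; apply: (well_orders_trans wo) wy.
Qed.

Lemma good_set0 : good set0.
Proof.
exists (fun _ _ => True); split => //.
- by split => // P P0 [x /P0].
- by move=> T N T0 _; exists N => x /T0.
Qed.

(** * Concatenation of well-orders along a locally constant index *)

Section Sum.
Context d (J : orderType d) (S : set X) (j : X -> J).
Hypothesis woJ : well_founded_le J.
Hypothesis jloc : forall x, S x -> nbhs x [set z | S z -> j z = j x].
Hypothesis gj : forall i, good (S `&` [set z | j z = i]).

(** [R] compares the indices first and then uses the order of the common piece. The least point of a
    piece is isolated, so the pieces are clopen for the interval topology as well, and the
    topological clauses of [good_order] can be checked one piece at a time. *)
Lemma good_sum : exists R, [/\ good_order S R,
  forall x y, R x y -> j x <= j y &
  forall x, S x -> interval_nbhs S R x [set z | j z = j x]].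
Proof.
have [Rj RjP] := choice gj.
pose W i := S `&` [set z | j z = i].
pose R x y := j x < j y \/ j x = j y /\ Rj (j x) x y.
have Rle x y : R x y -> j x <= j y by case=> [/ltW|[-> _]].
have RR x y : j x = j y -> R x y <-> Rj (j x) x y.
  move=> jxy; rewrite /R jxy ltxx; split => [[//|[]]|] //; by right.
have isoE x : S x -> isolated_in (W (j x)) x <-> isolated_in S x.
  move=> Sx; split=> iso.
    apply: filterS (filterI iso (jloc Sx)) => z [h1 h2] Sz.
    by apply: h1; split => //; exact: h2.
  by apply: filterS iso => z h [Sz _]; exact: h.
have wo : well_orders S R.
  split=> [x y Sx Sy xy yx|P PS [x Px]].
    have jxy : j x = j y by apply/le_anti; rewrite !Rle.
    have [[+ _] _ _ _] := RjP (j x); apply; [by split|by split| |].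
      by apply/RR.
    by rewrite jxy; apply/RR.
  have [|i [w Pw jw] imin] := woJ (P := [set j z | z in P]);
    first by exists (j x); exists x.
  have [[_ min] _ _ _] := RjP i.
  have [||m [Pm jm] mmin] := min [set z | P z /\ j z = i].
  - by move=> z [Pz jz]; split => //; exact: PS.
  - by exists w.
  exists m => // z Pz; have : i <= j z by apply: imin; exists z.
  rewrite /R jm le_eqVlt => /orP[/eqP iz|]; last by left.
  by right; split => //; apply: mmin.
have INE x U : S x ->
    interval_nbhs S R x U <-> interval_nbhs (W (j x)) (Rj (j x)) x U.
  move=> Sx; have Wx : W (j x) x by [].
  split=> -[Ux h]; split => //; case: h => [iso|[y [Sy xy] yU]].
  - by left; apply/isoE.
  - have [_] := good_order_interval_nbhsT (RjP (j x)) Wx.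
    case=> [|[w [[Sw jw] xw] _]]; first by left.
    have [jyx|jyx] := eqVneq (j y) (j x).
      right; exists y => [|z [Sz jz] zy zx].
        by split => // yx; apply: xy; apply/RR.
      by apply: yU => //; rewrite RR ?jz// jyx.
    (* Here [y] lies in an earlier piece, and the point [w] of the piece of [x] replaces it as left
       endpoint. *)
    right; exists w => // z [Sz jz] zw zx; apply: yU => //;
      last by rewrite RR jz.
    move=> /Rle; rewrite jz le_eqVlt eq_sym (negPf jyx) /= => xy'; apply: xy.
    by left.
  - by left; apply/isoE.
  - case: Sy => Sy jy; right; exists y => [|z Sz zy zx].
      by split => //; rewrite RR.
    have jz : j z = j x.
      apply/le_anti; rewrite Rle//= leNgt; apply/negP => zx'; apply: zy; left.
      by rewrite jy.
    apply: yU => //; first by move=> h; apply: zy; rewrite RR jz.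
    by move: zx; rewrite RR jz.
exists R; split => //; last first.
  move=> x Sx; apply/INE => //.
  have Wx : W (j x) x by [].
  by apply: interval_nbhsW (good_order_interval_nbhsT (RjP (j x)) Wx) =>
    // z [].
split => //.
- move=> x U Sx /INE-/(_ Sx) h.
  have [_ + _ _] := RjP (j x) => /(_ x U (conj Sx erefl) h) h'.
  apply: filterS (filterI h' (jloc Sx)) => z [h1 h2] Sz; apply: h1;
    split => //; exact: h2.
- move=> x Sx; have Wx : W (j x) x by [].
  have [_ _ /(_ x Wx)[u u1 u2] _] := RjP (j x).
  exists (fun n => u n `&` W (j x)) => [n|U].
    apply/INE => //; apply: interval_nbhsW (u1 n) => // z.
  move=> /INE-/(_ Sx)/u2[n nU]; exists n => z Sz [uz Wz]; exact: nU.
- move=> T N TS TN.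
  have /choice[P PP] i : exists P : X -> set X, forall x, T x -> j x = i ->
    [/\ P x x, interval_nbhs (W i) (Rj i) x [set z | T z -> j z = i -> P x z],
        forall z, T z -> j z = i -> P x z -> P z = P x
      & exists2 y, T y /\ j y = i & forall z, T z -> j z = i -> P x z -> N y z].
    have [_ _ _ /(_ (T `&` W i) N)] := RjP i; case.
    - by move=> z [].
    - move=> x [Tx [Sx jx]]; have /(INE _ _ Sx) := TN x Tx; rewrite jx.
      apply: interval_nbhsW => // z Wz h [Tz _]; exact: h.
    - move=> P PP; exists P => x Tx jx; case: (PP x).
        by split => //; split => //; exact: TS.
      move=> p1 p2 p3 [y [Ty [_ jy]] yN]; split => //.
      + by apply: interval_nbhsW p2 => [|z [Sz jz] h Tz _]; [by split => //;
          exact: TS|exact: h].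
      + by move=> z Tz jz; apply: p3; split => //; split => //; exact: TS.
      + by exists y => // z Tz jz; apply: yN; split => //; split => //;
          exact: TS.
  exists (fun x => P (j x) x `&` [set z | j z = j x]) => x Tx.
  have [p1 p2 p3 [y [Ty jy] yN]] := PP _ x Tx erefl.
  have Sx := TS _ Tx.
  split => //.
  + apply/INE => //; apply: interval_nbhsW p2 => // z [Sz jz] h Tz;
      split => //; exact: h.
  + by move=> z Tz [Pxz /= jz]; rewrite jz p3.
  + by exists y => // z Tz [Pxz jz]; apply: yN.
Qed.

End Sum.

(** * Adding a last point [p] near which the index [k] tends to infinity *)

Section Limit.
Context (S : set X) (p : X) (k : X -> nat).
Let S' := S `\ p.
Hypothesis kloc : forall x, S' x ->
  nbhs x [set z | z <> p /\ (S' z -> k z = k x)].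
Hypothesis kfar : forall n, nbhs p [set z | S' z -> (n <= k z)%N].
Hypothesis gk : forall i, good (S' `&` [set z | k z = i]).

(** The other points are ordered by increasing [k] first, and [p] comes last. If [p] is not
    isolated, its interval neighbourhoods are the sets containing [p] and all points with [k] at
    least some [n], which gives a countable base. *)
Lemma good_limit : S p -> good S.
Proof.
move=> Sp.
have kloc' x : S' x -> nbhs x [set z | S' z -> k z = k x].
  by move=> /kloc; apply: filterS => z [].
have [R0 [gR0 R0le kR0]] := good_sum nat_well_founded_le kloc' gk.
have [wo0 c1 c2 c3] := gR0.
pose R x y := y = p \/ [/\ x <> p, y <> p & R0 x y].
have RR x y : x <> p -> y <> p -> R x y <-> R0 x y.
  by move=> xp yp; split=> [[//|[]]//|h]; right.
have Rp y : R p y -> y = p by case=> [//|[]].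
have isoE x : S' x -> isolated_in S' x <-> isolated_in S x.
  move=> Sx; split=> iso; last by apply: filterS iso => z h [Sz _]; exact: h.
  by apply: filterS (filterI iso (kloc Sx)) => z [h [zp _]] Sz; apply: h.
have wo : well_orders S R.
  split=> [x y Sx Sy [->|[xp yp xy]]|P PS [x Px]].
  - by move=> /Rp.
  - by case=> [//|[_ _ yx]]; apply: wo0.1 => //; split.
  have [[y [Py yp]]|nP] := pselect (exists y, P y /\ y <> p); last first.
    exists x => // z Pz; left; apply: contrapT => zp; apply: nP; by exists z.
  have [||m [Pm mp] mmin] := wo0.2 (P `\ p).
  - by move=> z [Pz zp]; split => //; exact: PS.
  - by exists y.
  exists m => // z Pz; have [->|/eqP zp] := eqVneq z p; first by left.
  by right; split => //; apply: mmin.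
have INE x U : S' x -> interval_nbhs S R x U <-> interval_nbhs S' R0 x U.
  move=> S'x; have [Sx xp] := S'x.
  split=> -[Ux h]; split => //; case: h => [iso|[y [Sy xy] yU]].
  - by left; apply/isoE.
  - have yp : y <> p by move=> yp; apply: xy; left.
    right; exists y => [|z [Sz zp] zy zx]; first by split=> // h; apply: xy;
      apply/RR.
    by apply: yU => //; rewrite RR.
  - by left; apply/isoE.
  - case: Sy => Sy yp; right; exists y => [|z Sz zy zx]; first by split=> //;
      rewrite RR.
    have zp : z <> p by move=> zp; apply/xp/Rp; rewrite -zp.
    by apply: yU => //; [move=> h; apply: zy|]; apply/RR.
have INEp U : ~ isolated_in S p -> interval_nbhs S R p U <->
    U p /\ exists n, forall z, S' z -> (n <= k z)%N -> U z.
  move=> niso; split=> [[Up [//|[y [Sy py] yU]]]|[Up [n nU]]].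
    have yp : y <> p by move=> yp; apply: py; left.
    (* The successor is taken because points with the same index as [y] may come before [y]. *)
    split => //; exists (k y).+1 => z [Sz zp] yz; apply: yU => //; last by left.
    by move=> /RR-/(_ zp yp)/R0le; rewrite leEnat leqNgt yz.
  split => //; right.
  (* If no index reached [n], [kfar] would make [p] isolated. *)
  have [y [[Sy yp] ny]] : exists y, S' y /\ (n <= k y)%N.
    apply: contrapT => no; apply: niso; apply: filterS (kfar n) => z h Sz.
    apply: contrapT => zp; apply: no; exists z; split; first by split.
    by apply: h; split.
  exists y => [|z Sz zy _]; first by split => // /Rp.
  have [->//|/eqP zp] := eqVneq z p.
  apply: nU; first by split.
  case: (well_orders_total wo0 (x := y) (y := z)) => // [/R0le|/RR].
    by rewrite leEnat; exact: leq_trans.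
  by move=> /(_ zp yp).
(* A base at [p] in both cases: [K n] is the singleton of [p] if [p] is isolated, and a tail with
   [p] added otherwise. *)
pose K n := [set z | z = p \/ ~ isolated_in S p /\ (n <= k z)%N].
have KN n : interval_nbhs S R p (K n).
  have [iso|niso] := pselect (isolated_in S p); first by split; left.
  by apply/INEp => //; split; [left|exists n => z _ nz; right].
have Kmin U : interval_nbhs S R p U -> exists n, forall z, S z -> K n z -> U z.
  move=> pU; have [iso|niso] := pselect (isolated_in S p).
    by case: pU => Up _; exists 0%N => z Sz [->//|[]].
  move/(INEp _ niso): pU => [Up [n nU]]; exists n => z Sz Kz.
  have [->//|/eqP zp] := eqVneq z p.
  by case: Kz => [//|[_ nz]]; apply: nU.
have Kk n x z : S' x -> S' z -> k z = k x -> K n x -> K n z.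
  by move=> [_ xp] _ kzx [//|[niso nx]]; right; rewrite kzx.
have S'orp x : S x -> x = p \/ S' x.
  by move=> Sx; have [->|/eqP xp] := eqVneq x p; [left|right].
exists R; split => //.
- move=> x U /S'orp[->|S'x].
    move=> /Kmin[n nU].
    have : nbhs p [set z | S z -> K n z].
      have [iso|niso] := pselect (isolated_in S p).
        by apply: filterS iso => z h /h; left.
      apply: filterS (kfar n) => z h /S'orp[zp|S'z]; first by left.
      by right; split => //; exact: h.
    by apply: filterS => z h Sz; apply: nU => //; exact: h.
  move=> /INE-/(_ S'x)/(c1 _ _ S'x) h.
  apply: filterS (filterI h (kloc S'x)) => z [h1 [zp _]] Sz; exact: h1.
- move=> x /S'orp[->|S'x]; first by exists K.
  have [u u1 u2] := c2 x S'x; exists (fun n => u n `&` S') => [n|U].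
    by apply/INE => //; apply: interval_nbhsW (u1 n).
  by move=> /INE-/(_ S'x)/u2[n nU]; exists n => z Sz [uz Wz]; exact: nU.
- move=> T N TS TN.
  (* [K0] is the block that contains [p], or empty if [p] is not in [T]. Apart from [p] it is a
     union of fibres of [k], so removing it leaves neighbourhoods of the other points intact; the
     rest of [T] is partitioned by [c3]. *)
  have [K0 [K0k K0T TK0 K0N]] : exists K0 : set X, [/\
      forall x z, S' x -> S' z -> k z = k x -> K0 x -> K0 z,
      K0 !=set0 -> T p, T p -> interval_nbhs S R p K0 &
      forall z, T z -> K0 z -> N p z].
    have [Tp|Tp] := pselect (T p); last by exists set0; split => // -[].
    have [n nU] := Kmin _ (TN p Tp).
    exists (K n); split => // [x z|z Tz Kz]; first exact: Kk.
    by apply: nU => //; exact: TS.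
  have TS' x : T x -> ~ K0 x -> S' x.
    move=> Tx K0x; split; first exact: TS.
    by move=> xp; apply: K0x; rewrite xp in Tx *; have [] := TK0 Tx.
  have kN x (S'x : S' x) : interval_nbhs S' R0 x [set z | k z = k x] :=
    kR0 x S'x.
  have [||P PP] := c3 (T `\` K0) N.
  + by move=> x [Tx K0x]; exact: TS'.
  + move=> x [Tx K0x]; have S'x := TS' _ Tx K0x.
    have /(INE _ _ S'x) := TN x Tx.
    by apply: interval_nbhsW => // z _ h [Tz _]; exact: h.
  exists (fun x => if pselect (K0 x) then K0 else P x `\` K0) => x Tx.
  case: pselect => K0x /=.
    have Tp : T p by apply: K0T; exists x.
    split => //.
    + have [->|S'x] := S'orp _ (TS _ Tx).
        by apply: interval_nbhsW (TK0 Tp) => // z _ K0z _.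
      apply/INE => //; apply: interval_nbhsW (kN _ S'x) => // z S'z kz Tz.
      exact: K0k K0x.
    + by move=> z Tz K0z; case: pselect.
    + by exists p.
  have S'x := TS' _ Tx K0x.
  have [//|p1 p2 p3 [y [Ty K0y] yN]] := PP x.
  split => //.
  + apply/INE => //; apply: interval_nbhsW (interval_nbhsI wo0 S'x p2
      (kN _ S'x)) => // z S'z [h kz] Tz.
    have K0z : ~ K0 z by move=> /(K0k _ _ S'z S'x (esym kz)).
    by split => //; exact: h.
  + by move=> z Tz [Pz K0z]; case: pselect => [//|nK0z] /=; rewrite p3.
  + by exists y => // z Tz [Pz K0z]; apply: yN.
Qed.
End Limit.
End GoodSets.

(** * Spaces mapped into an ordinal *)

Section GoodSpace.
Context (X : topologicalType).
Hypothesis (psiX : countable_pseudocharacter X) (indX : ind_eq0 X).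

(** Enumerate a countable open family with intersection {p} and shrink each member to a basic clopen
    neighbourhood of [p]. *)
Lemma clopen_pseudobase (p : X) : exists U : nat -> set X,
  (forall n, clopen (U n) /\ U n p) /\ forall x, x <> p -> exists n, ~ U n x.
Proof.
have [F [cF oF FE]] := psiX p.
have /countable_injP[g ginj] := cF.
have [_ [B [_ Bb] Bcl]] := indX.
have Fp V : F V -> V p.
  by move=> FV; have : [set p] p by []; rewrite -FE; apply.
pose W n := [set z | forall V, F V -> g V = n -> V z].
have Wn n : nbhs p (W n).
  have [[V [FV gV]]|nV] := pselect (exists V, F V /\ g V = n).
    have : nbhs p V by apply: open_nbhs_nbhs; split; [exact: oF|exact: Fp].
    apply: filterS => z Vz V' FV' gV'.
    suff -> : V' = V by [].
    by apply: ginj; rewrite ?inE// gV'.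
  by apply: filterE => z V FV gV; exfalso; apply: nV; exists V.
have /choice[U UP] n : exists U, [/\ B U, U p & U `<=` W n].
  by have [U [BU Up] UW] := Bb p _ (Wn n); exists U.
exists U; split=> [n|x xp]; first by have [/Bcl] := UP n.
apply: contrapT => nU; apply: xp.
suff : [set p] x by [].
rewrite -FE => V FV.
have [_ _ /(_ x)] := UP (g V); apply => //.
by apply: contrapT => nUx; apply: nU; exists (g V).
Qed.

(** [k x] is the least [n] with [x] outside [U n]. Away from [p] its fibres are finite Boolean
    combinations of clopen sets, and it tends to infinity at [p] because [p] lies in every [U n]. *)
Lemma good_clopen_limit (S : set X) (p : X) :
  (forall T, T `<=` S `\ p -> good T) -> S p -> good S.
Proof.
move=> gS Sp; have [U [Ucl Usep]] := clopen_pseudobase p.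
have /choice[k kP] x : exists k, x <> p ->
    ~ U k x /\ forall m, (m < k)%N -> U m x.
  have [->|/eqP xp] := eqVneq x p; first by exists 0%N.
  have [n nU nmin] := @nat_well_founded_le [set n | ~ U n x] (Usep x xp).
  exists n => _; split => // m mn; apply: contrapT => /nmin.
  by rewrite leEnat leqNgt mn.
have Unb n x : U n x -> nbhs x (U n).
  by move=> Ux; apply: open_nbhs_nbhs; split => //; have [[]] := Ucl n.
apply: (good_limit (p := p) (k := k)) => //.
- move=> x [Sx xp]; have [nUx Ux] := kP x xp.
  have nUn : nbhs x (~` U (k x)).
    by apply: open_nbhs_nbhs; split => //; rewrite openC;
      have [[]] := Ucl (k x).
  apply: filterS (filterI nUn (nbhs_forall_ltn (fun m mk =>
    Unb m x (Ux m mk)))) => z [nUz Uz].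
  have zp : z <> p by move=> zp; apply: nUz; rewrite zp; have [] := Ucl (k x).
  split => // _; have [nUz' Uz'] := kP z zp.
  by case: (ltngtP (k z) (k x)) => // h; [case: nUz'; exact: Uz|case: nUz;
    exact: Uz'].
- move=> n; have := nbhs_forall_ltn (n := n) (fun m _ => Unb m p (Ucl m).2).
  apply: filterS => z Uz [_ zp]; have [nUz _] := kP z zp.
  by rewrite leqNgt; apply/negP => /Uz.
- by move=> i; apply: gS => z [].
Qed.

Context d (alpha : orderTopologicalType d) (A : set alpha)
  (f : X -> set_type A).
Hypothesis wo : well_founded_le alpha.
Hypothesis hpA : hereditarily_paracompact (set_type A).
Hypotheses (fcont : continuous f) (finj : injective f).

Let h x : alpha := val (f x).

(** The map [e] of [locally_constant_bound], pulled back along [h], cuts [S] into relatively clopen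
    pieces whose images are bounded in [Q]; [good_sum] concatenates their orders. *)
Lemma good_of_initial (Q : set alpha) (S : set X) :
  (forall x y, Q y -> x <= y -> Q x) -> (forall x, S x -> Q (h x)) ->
  (forall b T, Q b -> (forall x, T x -> h x <= b) -> good T) -> good S.
Proof.
move=> Qle SQ gQ; have [e eP] := locally_constant_bound wo hpA Qle.
have hA x : A (h x) := set_valP (f x).
have hcont : continuous h.
  by rewrite /h => x; apply: continuous_comp;
    [exact: fcont|exact: initial_continuous].
have [x Sx|i|R [gR _ _]] := good_sum wo (S := S) (j := e \o h).
- have [_ _ hx] := eP (h x) (hA x) (SQ x Sx).
  have {}hx : nbhs x [set z | A (h z) -> Q (h z) -> e (h z) = e (h x)].
    exact: hcont hx.
  by apply: filterS hx => z hz Sz; apply: hz => //; exact: SQ.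
- have [[x [Sx hx]]|nx] := pselect (S `&` [set z | (e \o h) z = i] !=set0).
    apply: (gQ i); first by rewrite -hx; have [] := eP (h x) (hA x) (SQ x Sx).
    by move=> z [Sz <-]; have [] := eP (h z) (hA z) (SQ z Sz).
  suff -> : S `&` [set z | (e \o h) z = i] = set0 by exact: good_set0.
  by apply/seteqP; split => // z Sz; apply: nx; exists z.
- by exists R.
Qed.

Lemma good_setT : good [set: X].
Proof.
(* [good_of_initial] serves twice: with [Q] everything, to pass from bounded sets to [X], and with
   [Q] the ordinals below [b], in the induction on [b]. *)
suff gle b : forall S, (forall x, S x -> h x <= b) -> good S.
  by apply: (@good_of_initial setT) => // b T _; exact: gle.
move: b; apply: (well_founded_le_ind wo) => b IH.
have glt S : (forall x, S x -> h x < b) -> good S.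
  move=> Sb; apply: (@good_of_initial [set x | x < b]) => //.
    by move=> x y /= yb xy; exact: le_lt_trans yb.
  by move=> c T /= cb Tc; exact: IH Tc.
(* By injectivity at most one point lies over [b]. *)
move=> S Sb; have [[p [Sp hp]]|np] := pselect (exists p, S p /\ h p = b).
  apply: good_clopen_limit Sp => T TS; apply: glt => x /TS[Sx xp].
  rewrite lt_neqAle Sb// andbT; apply/eqP => hx; apply: xp.
  by apply/finj/val_inj; rewrite -/(h x) -/(h p) hx hp.
apply: glt => x Sx; rewrite lt_neqAle Sb// andbT; apply/eqP => hx.
by apply: np; exists x.
Qed.
End GoodSpace.

(** * From the well-order to an ordinal *)

(** A copy of [T] whose type mentions [wo], so that the order given by [R] can be attached to it as
    a canonical structure. *)
Definition ordered_by (T : choiceType) (R : T -> T -> Prop)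
  (wo : well_orders [set: T] R) : Type := T.

Section OrderedBy.
Context (T : choiceType) (R : T -> T -> Prop) (wo : well_orders [set: T] R).
Local Notation L := (ordered_by wo).

Let le (x y : L) : bool := `[< R x y >].

Let le_refl : reflexive le.
Proof. by move=> x; apply/asboolP; exact: (well_orders_refl wo). Qed.

Let le_anti : antisymmetric le.
Proof. by move=> x y /andP[/asboolP xy /asboolP yx]; exact: wo.1. Qed.

Let le_trans : transitive le.
Proof.
move=> y x z /asboolP xy /asboolP yz.
exact/asboolP/(well_orders_trans wo _ _ _ xy yz).
Qed.

HB.instance Definition _ := Choice.on L.
HB.instance Definition _ :=
  Order.Le_isPOrder.Build (Order.Disp tt tt) L le_refl le_anti le_trans.

Let le_total : total (<=%O : rel L).
Proof.
move=> x y; apply/orP.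
by have [] := well_orders_total wo (x := x) (y := y) => // xy; [left|right];
  exact/asboolP.
Qed.

HB.instance Definition _ :=
  Order.POrder_isTotal.Build (Order.Disp tt tt) L le_total.

Lemma le_ordered_by (x y : L) : (x <= y) = `[< R x y >].
Proof. by []. Qed.

Lemma well_founded_le_ordered_by : well_founded_le L.
Proof.
move=> P Pn; have [//|m Pm mmin] := wo.2 P _ Pn.
by exists m => // z Pz; apply/asboolP/mmin.
Qed.

End OrderedBy.

Lemma well_founded_le_lexi d d' (T : orderType d) (T' : orderType d') :
  well_founded_le T -> well_founded_le T' -> well_founded_le (T *l T').
Proof.
move=> wo wo' P [[a b] Pab].
have [|m [b' Pmb'] mmin] := wo [set x | exists y, P (x, y)];
  first by exists a, b.
have [|m' Pm mmin'] := wo' [set y | P (m, y)]; first by exists b'.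
exists (m, m') => // -[x y] Pxy; rewrite leEprodlexi /= mmin; last by exists y.
by apply/implyP => xm; apply: mmin'; rewrite /= (_ : m = x)//; apply/le_anti;
   rewrite xm mmin //; exists y.
Qed.

Lemma well_founded_le_bool : well_founded_le bool.
Proof.
move=> P [x Px]; have [Pf|nPf] := pselect (P false); first by exists false.
exists true; first by case: x Px.
by case.
Qed.

Lemma well_founded_le_ordinal d (alpha : orderTopologicalType d) :
  well_founded_le alpha -> is_ordinal alpha.
Proof.
move=> wo; apply: wochoice.antisymmetric_well_order; first exact: le_anti.
move=> P [x Px]; have [|m Pm mmin] := wo [set z | z \in P]; first by exists x.
by exists m; split => // z; exact: mmin.
Qed.

Lemma nbhs_set_type (T : topologicalType) (A : set T) (x : set_type A) W :
  nbhs x W <->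
  exists2 V, nbhs (val x) V & forall y : set_type A, V (val y) -> W y.
Proof.
split=> [[O [[V oV <-] Vx] VW]|[V Vx VW]].
  by exists V => [|y Vy]; [apply: open_nbhs_nbhs; split|exact: VW].
have h : nbhs x (set_val @^-1` V) :=
  @initial_continuous _ _ (@set_val T A) x _ Vx.
by apply: filterS h.
Qed.

Lemma set_type_hausdorff (T : topologicalType) (A : set T) :
  hausdorff_space T -> hausdorff_space (set_type A).
Proof.
move=> hT p q pq; apply/val_inj/hT => V W Vp Wq.
have [||z [Vz Wz]] := pq (val @^-1` V) (val @^-1` W).
- by apply/nbhs_set_type; exists V.
- by apply/nbhs_set_type; exists W.
by exists (val z).
Qed.

Lemma ltxi_pairP d d' (T : orderType d) (T' : orderType d') (x y : T)
    (x' y' : T') :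
  ((x, x') : T *l T') < (y, y') <-> x < y \/ x = y /\ x' < y'.
Proof.
rewrite ltEprodlexi /=; case: (ltgtP x y) => [xy|xy|->] /=; split => //.
- by left.
- by case=> // -[xy' _]; move: xy; rewrite xy' ltxx.
- by right.
- by case=> // -[].
Qed.

(** * Spaces homeomorphic to [X] with the interval topology of a good order *)

Section IntervalTopology.
Context (X T : topologicalType) (R : X -> X -> Prop) (g : X -> T) (f : T -> X).
Hypothesis gR : good_order [set: X] R.
Hypotheses (gK : cancel g f) (fK : cancel f g) (hT : hausdorff_space T).
Hypothesis nbhsg : forall x W,
  nbhs (g x) W <-> interval_nbhs [set: X] R x (g @^-1` W).

Lemma interval_continuous : continuous g.
Proof.
have [_ c _ _] := gR => x W /nbhsg/c-/(_ I).
by apply: filterS => z; exact.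
Qed.

(** The images of the sets [u n] are neighbourhoods of [y] but need not be open, so their interiors
    serve as the base. *)
Lemma interval_first_countable : first_countable T.
Proof.
move=> y; have [_ _ /(_ (f y) I)[u u1 u2] _] := gR.
exists [set (g @` u n)^° | n in [set: nat]]; split.
- exact: card_image_le.
- move=> _ [n _ <-]; split; first exact: open_interior.
  rewrite /interior -{1}(fK y); apply/nbhsg.
  by apply: interval_nbhsW (u1 n) => // z _ uz; exists z.
- move=> V; rewrite -{1}(fK y) => /nbhsg/u2[n nV].
  exists (g @` u n)^°; first by exists n.
  by move=> z /interior_subset [x ux <-]; exact: nV.
Qed.

(** Each point of [A] picks a member of the cover containing it. Applied to this assignment,
    [partitionable] gives a refinement by pairwise disjoint open sets. *)
Lemma interval_hereditarily_paracompact : hereditarily_paracompact T.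
Proof.
move=> A; split; first exact: set_type_hausdorff.
move=> C [oC coverC].
have Av (a : set_type A) : A (val a) := set_valP a.
have /choice[U UP] x : exists U, A (g x) ->
    C U /\ exists2 a : set_type A, val a = g x & U a.
  have [Ax|] := pselect (A (g x)); last by exists set0.
  have gA : g x \in A by exact/mem_set.
  have : [set: set_type A] (exist (fun t => t \in A) _ gA) by [].
  by rewrite -coverC => -[U CU Ua]; exists U => _; split => //;
    exists (exist (fun t => t \in A) _ gA).
have [_ _ _ /(_ (g @^-1` A)
  (fun x => [set z | exists2 a : set_type A, val a = g z & U x a]))] := gR.
case=> // [x Ax|P PP].
  have [CU [a ax Ua]] := UP x Ax.
  have : nbhs a (U x) by apply: open_nbhs_nbhs; split => //; exact: oC.
  case/nbhs_set_type => V; rewrite ax => /nbhsg Vx VU.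
  apply: interval_nbhsW Vx => // z _ Vz Az.
  exists (exist (fun t => t \in A) _ (mem_set Az : g z \in A)) => //; exact: VU.
pose D x := [set a : set_type A | P x (f (val a))].
have fA (a : set_type A) : A (g (f (val a))) by rewrite fK; exact: Av.
have DE x (a : set_type A) : A (g x) -> D x a -> D (f (val a)) = D x.
  move=> Ax Da; have [_ _ Peq _] := PP x Ax.
  by rewrite /D Peq//; exact: fA.
have Dself (a : set_type A) : D (f (val a)) a by have [] := PP _ (fA a).
have oD x : A (g x) -> open (D x).
  move=> Ax; rewrite openE => a Da; rewrite /interior -(DE x a Ax Da).
  have [_ Pn _ _] := PP _ (fA a).
  apply/nbhs_set_type; exists [set t | A t -> P (f (val a)) (f t)].
    rewrite -{1}[val a]fK; apply/nbhsg.
    by apply: interval_nbhsW Pn => // z _ /= h Az; rewrite gK; exact: h.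
  by move=> b; exact: (fun h => h (Av b)).
exists [set D x | x in g @^-1` A]; split.
- split; first by move=> _ [x Ax <-]; exact: oD.
  apply/seteqP; split => // a _; exists (D (f (val a))); last exact: Dself.
  by exists (f (val a)) => //; exact: fA.
- move=> _ [x Ax <-]; have [_ _ _ [y Ay yN]] := PP x Ax.
  exists (U y); first by have [] := UP y Ay.
  move=> a Da; have [b ba Ub] := yN _ (fA a) Da.
  by suff -> : a = b by []; apply/val_inj; rewrite ba fK.
(* The block of [a] meets no other block. *)
- move=> a; exists (D (f (val a))).
    by apply: open_nbhs_nbhs; split => //; apply: oD; exact: fA.
  apply: (@sub_finite_set _ _ [set D (f (val a))]); last exact: finite_set1.
  move=> _ [[x Ax <-] [b [bx ba]]].
  exact: etrans (esym (DE _ _ Ax bx)) (DE _ _ (fA a) ba).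
Qed.

End IntervalTopology.

Theorem theorem2p5 (X : topologicalType)
  (psiX : countable_pseudocharacter X)
  (condX : exists (d : Order.disp_t) (alpha : orderTopologicalType d)
             (A : set alpha) (f : X -> set_type A),
      [/\ is_ordinal alpha, hereditarily_paracompact (set_type A)
        & continuous_bijection f])
  (indX : ind_eq0 X) :
  exists (d : Order.disp_t) (beta : orderTopologicalType d)
    (B : set beta) (g : X -> set_type B),
    [/\ is_ordinal beta, first_countable (set_type B),
        hereditarily_paracompact (set_type B) & continuous_bijection g].
Proof.
have [d [alpha [A [f [/ordinal_well_founded_le wo hpA [fc /bij_inj finj]]]]]]
  := condX.
have [R gR] := good_setT psiX indX wo hpA fc finj.
have [woR _ _ _] := gR.
pose L := ordered_by woR.
pose beta := order_topology (L *l bool).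
have wobeta : well_founded_le beta.
  apply: well_founded_le_lexi; first exact: well_founded_le_ordered_by.
  exact: well_founded_le_bool.
(* As the successor of [(x, false)], the point [(x, true)] is isolated in [beta]. *)
pose iso x := `[< isolated_in [set: X] x >].
pose h (x : X) : beta := ((x : L), iso x).
pose B := range h.
have hB x : h x \in B by apply/mem_set; exists x.
pose g x : set_type B := exist (fun t => t \in B) _ (hB x).
pose k (b : set_type B) : X := (val b : beta).1.
have gK : cancel g k by [].
have kK : cancel k g.
  by move=> b; apply/val_inj; have [x _ hx] := set_valP b;
    rewrite /k /= -[LHS]/(h _) -hx.
have ltL (y z : X) : (y : L) < z <-> ~ R z y.
  by rewrite ltNge le_ordered_by; split=> [/asboolP|?]; last exact/asboolP.
have nbhsg x W : nbhs (g x) W <-> interval_nbhs [set: X] R x (g @^-1` W).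
  split=> [Wx|[Wx [iso_x|[y [_ yx] yW]]]].
  - split; first exact: (nbhs_singleton Wx).
    have [V Vx VW] := (nbhs_set_type _ _).1 Wx.
    have [_ [|[y [_ yx] _]]] := good_order_interval_nbhsT gR (x := x) I;
      first by left.
    have [isox|nisox] := pselect (isolated_in [set: X] x); first by left.
    have isoF : iso x = false by exact/asboolP.
    have [[[l b] lx lV]|min] := nbhs_interval_left Vx; last first.
      have : h y < h x by apply/ltxi_pairP; left; exact/ltL.
      by rewrite ltNge min.
    (* No boolean is below [false], so [(l, b) < h x] gives [l < x] in [L]. *)
    right; exists l => [|z _ lz zx].
      by split => //; move: lx => /ltxi_pairP[/ltL//|[_]]; rewrite isoF;
        case: b {lV}.
    apply: VW; apply: lV; first by apply/ltxi_pairP; left; exact/ltL.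
    rewrite leNgt; apply/negP => /ltxi_pairP[/ltL//|[xz]];
      rewrite -xz /iso ltxx //.
  - apply/nbhs_set_type;
      exists [set t | ((x : L, false) : beta) < t /\ t <= h x].
      apply: filterI; last exact: (nbhs_lray wobeta).
      by apply: nbhs_rray; apply/ltxi_pairP; right; split => //;
        rewrite /iso (asboolT iso_x).
    move=> w; rewrite -[w]kK; move: (k w) => z [/ltxi_pairP xz].
    rewrite leNgt => zx.
    suff <- : x = z by [].
    case: xz => [xz|[]//]; exfalso; move/negP: zx; apply.
    by apply/ltxi_pairP; left.
  (* The endpoint [(y, true)] excludes [h y] whatever its second coordinate is. *)
  - apply/nbhs_set_type;
      exists [set t | ((y : L, true) : beta) < t /\ t <= h x].
      apply: filterI; last exact: (nbhs_lray wobeta).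
      by apply: nbhs_rray; apply/ltxi_pairP; left; exact/ltL.
    move=> w; rewrite -[w]kK; move: (k w) => z [/ltxi_pairP yz].
    rewrite leNgt => zx; apply: yW => //.
      by case: yz => [/ltL//|[_]]; case: (iso z).
    apply: contrapT => /ltL xz; move/negP: zx; apply.
    by apply/ltxi_pairP; left.
have hausB : hausdorff_space (set_type B).
  by apply: set_type_hausdorff; exact: order_hausdorff.
exists _, beta, B, g; split.
- exact: well_founded_le_ordinal.
- exact: interval_first_countable gR kK nbhsg.
- exact: interval_hereditarily_paracompact gR gK kK hausB nbhsg.
- by split; [exact: interval_continuous gR nbhsg|exists k].
Qed.
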